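(* Let $n\ge1$. (i) For $L\in\mathbb Z_{\ge0}$, $$\sum_{j=1}^n\frac{\tilde h_j^L}{\chi_j}=\begin{cases}0,&L=0,1,\dots,n-2,\\ H_{L-n+1},&L\ge n-1.\end{cases}$$ (ii) The space $\mathcal H$ is a subspace of $\mathcal W$. Moreover, an element $\sigma\in U(n)$ satisfies the system $\Delta_i\Delta_j(\tilde h_{ij}\sigma)=0$, $i,j=1,\dots,n$, if and only if $\sigma\in\mathcal H$, that is, $\mathcal H=\mathcal W\cap U(n)$. The symmetric group $\mathbb S_n$ acts on the ring $\bar U(n)$ and on the space $\mathcal W$ by permutations of the variables $\tilde h_1,\dots,\tilde h_n$, and $\mathcal H=\mathcal W^{\mathbb S_n}$, the subspace of $\mathbb S_n$-invariants in $\mathcal W$. (iii) For every $j\in\{1,\dots,n\}$ there is a direct sum decomposition $$\mathcal W=\bigoplus_{k:\,k\ne j}\mathcal W_k\oplus\mathcal H.$$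
   Context: $\mathbb K$ is a field of characteristic $0$. $U(n)=\mathbb K[\tilde h_1,\dots,\tilde h_n]$ is the commutative polynomial ring, $\tilde h_{ij}=\tilde h_i-\tilde h_j$, and $\bar U(n)$ is the localization of $U(n)$ with respect to the multiplicative set generated by all $\tilde h_{ij}+a$, $a\in\mathbb Z$, $i\ne j$. For $p\in\bar U(n)$, $p[-\varepsilon_j]$ denotes the image of $p$ under the automorphism $\tilde h_i\mapsto\tilde h_i-\delta_{ij}$ ($i=1,\dots,n$). $\Delta_j f:=f-f[-\varepsilon_j]$. $\chi_j:=\prod_{k\ne j}\tilde h_{jk}$. $\mathcal W_j$ is the $\mathbb K$-vector space of elements $\pi(\tilde h_j)/\chi_j\in\bar U(n)$ with $\pi$ a univariate polynomial over $\mathbb K$, and $\mathcal W:=\sum_{j=1}^n\mathcal W_j$. $H_L=\sum_{i_1\le\dots\le i_L}\tilde h_{i_1}\cdots\tilde h_{i_L}$, $L\ge0$, are the complete symmetric polynomials in $\tilde h_1,\dots,\tilde h_n$ ($H_0=1$), and $\mathcal H$ is the $\mathbb K$-linear span of $H_0,H_1,H_2,\dots$. *)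

(* Defs.v *)
From HB Require Import structures.
From mathcomp Require Import all_boot all_order perm all_algebra.
From mathcomp Require Import mpoly.

Set Implicit Arguments.
Unset Strict Implicit.
Unset Printing Implicit Defensive.

Import GRing.Theory.
Local Open Scope ring_scope.
Local Open Scope quotient_scope.

Notation "x %:F" := (@FracField.tofrac _ x) : ring_scope.

(* The extension to fraction fields of an injective ring morphism [f]; for   *)
(* such an [f] the value does not depend on the representative, cf.          *)
(* [fracmap_div] below.                                                      *)
Definition fracmap (R S : idomainType) (f : R -> S)
    (x : {fraction R}) : {fraction S} :=
  (f \n_(repr x))%:F / (f \d_(repr x))%:F.

Lemma frac_numden (R : idomainType) (x : {fraction R}) :
  x = (\n_(repr x))%:F / (\d_(repr x))%:F.
Proof.
apply: (canRL (mulfK _)); first by rewrite tofrac_eq0 denom_ratioP.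
rewrite -{1}[x]reprK; unlock FracField.tofrac.
rewrite -[LHS]FracField.pi_mul; apply/eqmodP; rewrite /= /equivf.
by rewrite /FracField.mulf !numden_Ratio ?mulr1 ?oner_neq0 ?denom_ratioP // mulrC.
Qed.

Lemma fracmap_div (R S : idomainType) (f : {rmorphism R -> S}) (a b : R) :
  injective f -> b != 0 -> fracmap f (a%:F / b%:F) = (f a)%:F / (f b)%:F.
Proof.
move=> f_inj b_neq0; rewrite /fracmap.
move: (frac_numden (a%:F / b%:F)) (denom_ratioP (repr (a%:F / b%:F))).
move: (\n_ _) (\d_ _) => c d.
have f_neq0 y : y != 0 -> (f y)%:F != 0.
  by rewrite tofrac_eq0; apply: contraNneq => fy0; apply/eqP/f_inj; rewrite rmorph0.
move=> /eqP + d_neq0; rewrite eqr_div ?tofrac_eq0 // -!tofracM tofrac_eq.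
move=> /eqP E; apply/esym/eqP.
by rewrite eqr_div ?f_neq0 // -!tofracM tofrac_eq -!rmorphM E.
Qed.

Section Ring.
Variables (K : fieldType) (n : nat).

Local Notation U := {mpoly K[n]}.
Local Notation F := {fraction U}.

Definition const (a : K) : F := (a%:MP_[n])%:F.

(* The multiplicative set generated by all h_i - h_j + a, i != j, a integer. *)
Inductive denominator : U -> Prop :=
| denominator1 : denominator 1
| denominatorM (i j : 'I_n) (a : int) (d : U) :
    i != j -> denominator d -> denominator (('X_i - 'X_j + a%:~R) * d).

(* U(n) and its localization, as subrings of the field of fractions F. *)
Definition in_U (x : F) : Prop := exists p : U, x = p%:F.
Definition in_barU (x : F) : Prop :=
  exists p d : U, denominator d /\ x = p%:F / d%:F.

Definition mshift (j : 'I_n) (p : U) : U :=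
  p \mPo [tuple 'X_i - (i == j)%:R | i < n].

Lemma mshift_inj j : injective (mshift j).
Proof.
pose g (p : U) := p \mPo [tuple 'X_i + (i == j)%:R | i < n].
apply: (can_inj (g := g)) => p; rewrite /mshift /g.
rewrite [RHS](mpolyE p) (comp_mpolyE p) raddf_sum; apply: eq_bigr => m _ /=.
rewrite comp_mpolyZ rmorph_prod mpolyXE_id; congr (_ *: _); apply: eq_bigr => i _.
rewrite rmorphXn /= tnth_mktuple rmorphB rmorph_nat /= comp_mpolyXU.
by rewrite -tnth_nth tnth_mktuple addrK.
Qed.

(* x[-eps_j] *)
Definition shift (j : 'I_n) : F -> F := fracmap (mshift j).
Definition Delta (j : 'I_n) (x : F) : F := x - shift j x.

(* [msym s] maps 'X_i to 'X_(s i). As permutations are multiplied by         *)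
(* (s * t) i = t (s i), this is an action in the MathComp (right) sense.     *)
Definition permute (x : F) (s : 'S_n) : F := fracmap (msym s) x.

(* [to] restricts to an action of S_n by K-algebra endomorphisms on the      *)
(* subring A of F.                                                           *)
Definition acts_on_ring (A : F -> Prop) (to : F -> 'S_n -> F) : Prop :=
  [/\ forall x s, A x -> A (to x s),
      forall x, A x -> to x 1%g = x
        & forall x s t, A x -> to x (s * t)%g = to (to x s) t]
  /\ [/\ forall x y s, A x -> A y -> to (x + y) s = to x s + to y s,
         forall x y s, A x -> A y -> to (x * y) s = to x s * to y s
           & forall a s, to (const a) s = const a].

Definition subspace (A : F -> Prop) : Prop :=
  A 0 /\ forall a x y, A x -> A y -> A (const a * x + y).

Definition space_sum (I : finType) (A : I -> F -> Prop) (x : F) : Prop :=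
  exists v : I -> F, (forall i, A i (v i)) /\ x = \sum_i v i.

Definition direct_sum (I : finType) (A : I -> F -> Prop) (B : F -> Prop) :=
  (forall x, B x <-> space_sum A x) /\
  (forall v : I -> F, (forall i, A i (v i)) ->
     \sum_i v i = 0 -> forall i, v i = 0).

Definition chi (j : 'I_n) : U := \prod_(k < n | k != j) ('X_j - 'X_k).

Definition Wj (j : 'I_n) (x : F) : Prop :=
  exists pi : {poly K}, x = (horner_alg ('X_j : U) pi)%:F / (chi j)%:F.

Definition W : F -> Prop := space_sum Wj.

Lemma denominator_neq0 d : denominator d -> d != 0.
Proof.
elim=> [|i j a e ij _ e_neq0]; rewrite ?oner_neq0 // mulf_neq0 //.
apply/eqP => /(congr1 (fun p : U => p@_U_(i))) /eqP.
rewrite mcoeff0 mcoeffD mcoeffB !mcoeffXU raddfMz /= mcoeff1 mnm1_eq0 mul0rz.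
by rewrite eqxx [j == i]eq_sym (negPf ij) subr0 addr0 oner_eq0.
Qed.

Lemma denominatorMM d e :
  denominator d -> denominator e -> denominator (d * e).
Proof.
move=> + de; elim=> [|i j a d' ij _ IH]; first by rewrite mul1r.
by rewrite -mulrA; apply: denominatorM.
Qed.

Lemma W_in_barU x : W x -> in_barU x.
Proof.
case=> v [vW ->]; elim/big_rec: _ => [|j y _ [q [e [de ->]]]].
  by exists 0, 1; rewrite tofrac0 mul0r; split=> //; constructor.
have [pi ->] := vW j.
have dchi : denominator (chi j).
  rewrite /chi; elim/big_rec: _ => [|k d kj dd]; first by constructor.
  rewrite -['X_j - 'X_k]addr0 -(mulr0z 1); apply: denominatorM => //.
  by rewrite eq_sym.
exists (horner_alg ('X_j : U) pi * e + q * chi j), (chi j * e).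
split; first exact: denominatorMM.
rewrite addf_div ?tofrac_eq0 ?denominator_neq0 //.
by rewrite tofracD !tofracM.
Qed.

Definition hcomplete (L : nat) : U :=
  \sum_(t : L.-tuple 'I_n | sorted leq (map val t)) \prod_(i <- t) 'X_i.

Definition Hspan (x : F) : Prop :=
  exists (N : nat) (c : nat -> K), x = (\sum_(L < N) c L *: hcomplete L)%:F.

End Ring.

Arguments in_barU {K n} x.
Arguments permute {K n} x s.
Arguments chi K {n} j.
Arguments W K n x : clear implicits.
Arguments hcomplete K n L : clear implicits.
Arguments Hspan K n x : clear implicits.

(* Main.v *)
(* In characteristic 0, a polynomial fixed by a unit shift of a variable does *)
(* not depend on it, so the system says that (h_i - h_j) sigma has no monomial *)
(* divisible by h_i h_j. Comparing coefficients, this means that moving one    *)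
(* unit of exponent from h_i to h_j never changes a coefficient of sigma, i.e. *)
(* that sigma is a combination of the H_L.                                     *)
(*   The sums in (i) are divided differences of the powers, and satisfy the    *)
(* same recurrence as complete symmetric polynomials in a subset of variables. *)
(* Hence the elements of H are the sums of pi(h_j)/chi_j with the same pi for  *)
(* all j. Conversely, if a sum of pi_j(h_j)/chi_j is a polynomial, then the    *)
(* vanishing of its residue at h_i = h_k forces pi_i = pi_k; this yields the   *)
(* remaining parts of (ii) and (iii).                                          *)
Require Import Defs.
From HB Require Import structures.
From mathcomp Require Import all_boot all_order perm all_algebra.
From mathcomp Require Import mpoly ring.

Set Implicit Arguments.
Unset Strict Implicit.
Unset Printing Implicit Defensive.

Import GRing.Theory.
Local Open Scope ring_scope.


(** The sums in (i) are divided differences of a power at the nodes h_j. Divided differences over a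
    set of nodes ([divdiffD1]) and complete symmetric polynomials in a set of variables
    ([mulXB_hcomplete_on]) obey the same recurrence under removal of one of two elements, so
    induction from singletons gives (i). By linearity H consists of the diagonal elements of W,
    those whose numerators pi_j are one and the same polynomial ([HspanP]).

    The converse tool is [regular_eq]: only the terms i and k of an element of W can have a pole
    along h_i = h_k, and these poles cancel only if pi_i = pi_k. So an element of W that is a
    polynomial, in particular 0, is diagonal ([wfrac_sum_mpoly]). This gives H as the intersection
    of W and U(n), directness in (iii), and, applied to x minus its image under a transposition, the
    invariants.

    For the system, characteristic 0 turns a vanishing second difference into a vanishing mixed
    derivative ([mDelta2_mderiv]). Applied to (h_i - h_j) sigma, this equates coefficients of sigma
    whose monomials differ by moving one unit of exponent, so that they depend on the degree only
    ([hcomplete_uniq]). Conversely (h_i - h_j) H_L is a term free of h_j minus a term free of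
    h_i. *)

Lemma pchar0_natr_inj (F : fieldType) :
  [pchar F] =i pred0 -> injective (fun k : nat => k%:R : F).
Proof.
move=> charF k l; wlog kl : k l / (k <= l)%N => [wl|].
  by case: (leqP k l) => [/wl//|/ltnW/wl + /esym] => /[apply].
move/eqP; rewrite eq_sym -subr_eq0 -natrB // ((pcharf0P F).1 charF) subn_eq0 => lk.
by apply/eqP; rewrite eqn_leq kl.
Qed.

(** * Finite differences and derivatives of polynomials *)

Section MDelta.
Variables (K : fieldType) (n : nat).
Implicit Types (p q : {mpoly K[n]}) (i j : 'I_n).

Lemma comp_mpolyA p (t u : n.-tuple {mpoly K[n]}) :
  (p \mPo t) \mPo u = p \mPo [tuple tnth t i \mPo u | i < n].
Proof.
rewrite (comp_mpolyE p t) raddf_sum /= (comp_mpolyE p).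
apply: eq_bigr => m _; rewrite comp_mpolyZ rmorph_prod; congr (_ *: _).
by apply: eq_bigr => i _; rewrite rmorphXn tnth_mktuple.
Qed.

Lemma tnth_comp_mpolyXU i (t : n.-tuple {mpoly K[n]}) : 'X_i \mPo t = tnth t i.
Proof. by rewrite comp_mpolyXU -tnth_nth. Qed.

Lemma mderivXU i j : ('X_j : {mpoly K[n]})^`M(i) = (j == i)%:R.
Proof.
rewrite mderivX mnm1E; case: eqP => [->|_]; last by rewrite scale0r.
have -> : (U_(i) - U_(i) = 0)%MM by apply/mnmP => k; rewrite mnmBE subnn mnm0E.
by rewrite mpolyX0 scale1r.
Qed.

(** The chain rule. The Leibniz rule carries it from variables to products, and linearity does the
    rest. *)
Lemma mderiv_comp i p (t : n.-tuple {mpoly K[n]}) :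
  (p \mPo t)^`M(i) = \sum_l (p^`M(l) \mPo t) * (tnth t l)^`M(i).
Proof.
pose P q := (q \mPo t)^`M(i) = \sum_l (q^`M(l) \mPo t) * (tnth t l)^`M(i).
have P1 : P 1.
  rewrite /P comp_mpoly1 -mpolyC1 mderivC big1 // => l _.
  by rewrite mderivC comp_mpoly0 mul0r.
have PM q r : P q -> P r -> P (q * r).
  rewrite /P rmorphM /= mderivM => -> ->.
  rewrite mulr_suml mulr_sumr -big_split /=; apply: eq_bigr => l _.
  rewrite mderivM rmorphD !rmorphM /= mulrDl mulrA; congr (_ + _).
  by rewrite mulrAC.
elim/mpolyind: p => [|c m p _ _ IH].
  rewrite comp_mpoly0 mderiv0 big1 // => l _.
  by rewrite mderiv0 comp_mpoly0 mul0r.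
have PX : P 'X_[m].
  rewrite mpolyXE_id; apply: (big_ind P) => // l _.
  elim: (m l) => [|d IHd]; first by rewrite expr0.
  rewrite exprS; apply: PM IHd.
  rewrite /P tnth_comp_mpolyXU (bigD1 l) //= mderivXU eqxx comp_mpoly1 mul1r.
  rewrite big1 ?addr0 // => k /negPf kl.
  by rewrite mderivXU eq_sym kl comp_mpoly0 mul0r.
rewrite raddfD /= mderivD comp_mpolyZ mderivZ IH PX scaler_sumr -big_split /=.
apply: eq_bigr => l _.
by rewrite mderivD mderivZ raddfD /= comp_mpolyZ mulrDl scalerAl.
Qed.

Lemma mderiv_mshift i j p : (mshift j p)^`M(i) = mshift j p^`M(i).
Proof.
rewrite /mshift mderiv_comp (bigD1 i) //= big1 ?addr0 => [|l /negPf li].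
  by rewrite tnth_mktuple -mpolyC_nat mderivB mderivC mderivXU eqxx subr0 mulr1.
by rewrite tnth_mktuple -mpolyC_nat mderivB mderivC mderivXU li subr0 mulr0.
Qed.

Lemma mshiftC i j p : mshift i (mshift j p) = mshift j (mshift i p).
Proof.
rewrite /mshift !comp_mpolyA; apply: (congr1 (fun t => p \mPo t)).
apply: eq_mktuple => l.
by rewrite !tnth_mktuple !rmorphB !rmorph_nat /= !tnth_comp_mpolyXU
  !tnth_mktuple addrAC.
Qed.

Definition mDelta j p := p - mshift j p.

Lemma mDelta_lin j N (c : 'I_N -> K) (q : 'I_N -> {mpoly K[n]}) :
  mDelta j (\sum_L c L *: q L) = \sum_L c L *: mDelta j (q L).
Proof.
rewrite /mDelta /mshift [_ \mPo _]raddf_sum -sumrB; apply: eq_bigr => L _.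
by rewrite /= comp_mpolyZ scalerBr.
Qed.

Hypothesis charK : [pchar K] =i pred0.

(* [q] below is [p] with ['X_i - T] in place of ['X_i]: it takes the value [p] *)
(* at all natural numbers [T], hence is constant, and [T := 'X_i] shows that   *)
(* [p] does not depend on ['X_i].                                              *)
Lemma mshift_id_mderiv i p : mshift i p = p -> p^`M(i) = 0.
Proof.
move=> pi.
pose t (c : {mpoly K[n]}) := [tuple 'X_l - (l == i)%:R * c | l < n].
pose q : {poly {mpoly K[n]}} := \sum_(m <- msupp p) (p@_m)%:MP%:P *
  \prod_l (('X_l)%:P - (l == i)%:R *: 'X) ^+ m l.
have qE c : q.[c] = p \mPo t c.
  rewrite horner_sum comp_mpolyE; apply: eq_bigr => m _.
  rewrite hornerM hornerC mul_mpolyC horner_prod; congr (_ *: _).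
  by apply: eq_bigr => l _; rewrite !hornerE tnth_mktuple.
have q_nat k : q.[(k%:R)%:MP] = p.
  rewrite qE; elim: k => [|k IHk].
    rewrite -[RHS]comp_mpoly_id; congr (_ \mPo _); apply: eq_mktuple => l.
    by rewrite mpolyC0 mulr0 subr0.
  rewrite -{2}IHk -{2}pi /mshift comp_mpolyA; congr (_ \mPo _).
  apply: eq_mktuple => l.
  rewrite tnth_mktuple rmorphB !rmorph_nat /= tnth_comp_mpolyXU tnth_mktuple.
  by rewrite -addn1 natrD mulrDr mulr1 opprD addrA.
have q_const : q = p%:P.
  apply/subr0_eq; pose s := [seq (k%:R : K)%:MP_[n] | k <- iota 0 (size (q - p%:P))].
  apply: (@roots_geq_poly_eq0 _ _ s); last by rewrite size_map size_iota.
    by apply/allP => _ /mapP[k _ ->]; rewrite /root !hornerE q_nat subrr.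
  by rewrite map_inj_uniq ?iota_uniq // => k l /(can_inj (@mpolyCK _ _))/pchar0_natr_inj; apply.
have -> : p = p \mPo t 'X_i by rewrite -qE q_const hornerC.
rewrite mderiv_comp big1 // => l _; rewrite tnth_mktuple mderivB mderivXU.
case: eqP => [->|_]; last by rewrite mul0r mderiv0 subr0 mulr0.
by rewrite mul1r mderivXU eqxx subrr mulr0.
Qed.

(** The shift in i fixes [mDelta j p], whose derivative in i is therefore 0. As derivatives commute
    with shifts, the shift in j then fixes the derivative of [p] in i. *)
Lemma mDelta2_mderiv i j p :
  mDelta i (mDelta j p) = 0 -> p^`M(i)^`M(j) = 0.
Proof.
move/subr0_eq/esym/mshift_id_mderiv/eqP; rewrite mderivB mderiv_mshift subr_eq0.
by move=> /eqP/esym/mshift_id_mderiv.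
Qed.

(** Differentiating multiplies this coefficient by two positive integers, which are nonzero in
    characteristic 0. *)
Lemma mderiv2_eq0_mcoeff i j p : p^`M(i)^`M(j) = 0 ->
  forall m, p@_(m + U_(j) + U_(i)) = 0.
Proof.
move=> pij m; move/(congr1 (mcoeff m)): pij.
rewrite !mcoeff_deriv mcoeff0 -mulr_natr -[X in X * _]mulr_natr => /eqP.
by rewrite !mulf_eq0 !((pcharf0P K).1 charK) /= !orbF => /eqP.
Qed.

End MDelta.

(** * Complete symmetric polynomials through their coefficients *)

Section Complete.
Variables (K : fieldType) (n : nat).
Implicit Types (p q : {mpoly K[n]}) (i j : 'I_n) (m : 'X_{1..n}) (A : {set 'I_n}).

Lemma mcoeffMXU i p m :
  (p * 'X_i)@_m = if m i == 0%N then 0 else p@_(m - U_(i)).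
Proof.
case: ifPn => [/eqP mi0|mi].
  rewrite {1}(mpolyE p) mulr_suml raddf_sum big1 // => k _ /=.
  rewrite -scalerAl -mpolyXD mcoeffZ mcoeffX; case: eqP => [E|]; last by rewrite mulr0.
  by move: mi0; rewrite -E mnmDE mnm1E eqxx addn1.
by rewrite -{1}(submK (m := U_(i)%MM) (m' := m)) ?lep1mP // addmC mcoeffMX.
Qed.

(** Each monomial of degree [L] comes from exactly one sorted tuple, the sorted list [s] of its
    variables with multiplicity. *)
Lemma mcoeff_hcomplete L m : (hcomplete K n L)@_m = (mdeg m == L)%:R.
Proof.
pose mon (t : seq 'I_n) : 'X_{1..n} := (\sum_(i <- t) U_(i))%MM.
have monE t i : mon t i = count_mem i t.
  rewrite mnm_sumE -sum1_count [RHS]big_mkcond; apply: eq_bigr => j _.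
  by rewrite mnm1E /=; case: eqP.
have mdeg_mon t : mdeg (mon t) = size t.
  by rewrite mdeg_sum -sum1_size; apply: eq_bigr => j _; rewrite mdeg1.
rewrite /hcomplete raddf_sum /=.
under eq_bigr => t _ do rewrite -(big_map (fun i => U_(i)%MM) xpredT (fun k => 'X_[k]))
   mpolyX_prod big_map mcoeffX -/(mon t).
have [mL|mL] := eqVneq (mdeg m) L; last first.
  rewrite big1 // => t _; case: eqP => // E.
  by rewrite -E mdeg_mon size_tuple eqxx in mL.
pose le := relpre (val : 'I_n -> nat) leq.
have le_tr : transitive le by move=> ? ? ?; apply: leq_trans.
have le_anti : antisymmetric le.
  by move=> i j; rewrite /le /= -eqn_leq => /eqP/val_inj.
have le_total : total le by move=> i j; apply: leq_total.
pose s := sort le (flatten [seq nseq (m i) i | i <- enum 'I_n]).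
have count_s i : count_mem i s = m i.
  rewrite count_sort count_flatten -map_comp sumnE big_map big_enum /=.
  rewrite (bigD1 i) //= count_nseq /= eqxx mul1n big1 ?addn0 // => j.
  by rewrite count_nseq /= => /negPf->.
have mon_s : mon s = m by apply/mnmP => i; rewrite monE.
have size_s : size s == L by rewrite -mdeg_mon mon_s mL.
rewrite (bigD1 (Tuple size_s)) /= ?sorted_map ?sort_sorted // mon_s eqxx.
rewrite big1 ?addr0 // => t /andP[t_sorted /eqP ts].
case: eqP => // tm; case: ts; apply: val_inj => /=.
apply: (sorted_eq le_tr le_anti); rewrite ?sort_sorted -?sorted_map //.
apply/allP => i _ /=; apply/eqP.
by rewrite -monE tm count_s.
Qed.

Definition mnm_on (A : {set 'I_n}) m := [forall i, (m i != 0%N) ==> (i \in A)].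

(** The complete symmetric polynomial in the variables of [A], written as a sum of monomials; the
    bound [L.+1] only makes the index type finite. *)
Definition hcomplete_on (A : {set 'I_n}) (L : nat) : {mpoly K[n]} :=
  \sum_(m : 'X_{1..n < L.+1} | (mdeg m == L) && mnm_on A m) 'X_[m].

Lemma mcoeff_hcomplete_on A L m :
  (hcomplete_on A L)@_m = ((mdeg m == L) && mnm_on A m)%:R.
Proof.
rewrite /hcomplete_on raddf_sum /=; have [mA|mA] := boolP ((mdeg m == L) && mnm_on A m).
  have mL : (mdeg m < L.+1)%N by case/andP: mA => /eqP->.
  rewrite (bigD1 (BMultinom mL : 'X_{1..n < L.+1})) //= mcoeffX eqxx big1 ?addr0 // => k /andP[_ km].
  by rewrite mcoeffX; move: km; rewrite bmeqP => /negPf->.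
rewrite big1 // => k kA; rewrite mcoeffX; case: eqP => // E.
by rewrite E (negPf mA) in kA.
Qed.

Lemma hcomplete_onT L : hcomplete_on setT L = hcomplete K n L.
Proof.
apply/mpolyP => m; rewrite mcoeff_hcomplete_on mcoeff_hcomplete.
rewrite (_ : mnm_on _ _) ?andbT //.
by apply/forallP => i; rewrite in_setT implybT.
Qed.

Lemma mnm_onD1 A i m : mnm_on (A :\ i) m = (m i == 0%N) && mnm_on A m.
Proof.
apply/forallP/andP => [mA|[/eqP mi /forallP mA] k].
  split; first by move: (mA i); rewrite !inE eqxx /=; case: eqP.
  by apply/forallP => k; apply/implyP => /(implyP (mA k)); case/setD1P.
rewrite in_setD1; have [->|_] := eqVneq k i; first by rewrite mi.
exact: mA.
Qed.

Lemma mnm_onBU A i m : i \in A -> mnm_on A (m - U_(i))%MM = mnm_on A m.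
Proof.
move=> iA; apply: eq_forallb => k; rewrite mnmBE mnm1E.
by have [<-|_] := eqVneq i k; rewrite ?iA ?implybT ?subn0.
Qed.

(** At a monomial of degree [L.+1] in the variables of [A], both sides have coefficient [h_i occurs]
    - [h_j occurs]. *)
Lemma mulXB_hcomplete_on A i j L : i \in A -> j \in A ->
  ('X_i - 'X_j) * hcomplete_on A L =
    hcomplete_on (A :\ j) L.+1 - hcomplete_on (A :\ i) L.+1.
Proof.
move=> iA jA; apply/mpolyP => m.
rewrite mulrC mulrBr !mcoeffB !mcoeffMXU !mcoeff_hcomplete_on !mnm_onBU //.
rewrite !mnm_onD1.
have mdegBU k : m k != 0%N -> (mdeg (m - U_(k))%MM == L) = (mdeg m == L.+1).
  move=> mk; rewrite -[in RHS](submK (m := U_(k)%MM) (m' := m)) ?lep1mP //.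
  by rewrite mdegD mdeg1 addn1 eqSS.
have [_|/mdegBU->] := eqVneq (m i) 0%N; have [_|/mdegBU->] := eqVneq (m j) 0%N;
  by rewrite /= ?andbF ?subrr.
Qed.

Lemma mshift_hcomplete_on A i L : i \notin A ->
  mshift i (hcomplete_on A L) = hcomplete_on A L.
Proof.
move=> iA; rewrite /mshift raddf_sum; apply: eq_bigr => m /andP[_ mA].
rewrite /= comp_mpolyX [RHS]mpolyXE_id; apply: eq_bigr => k _.
rewrite tnth_mktuple; case: eqP => [->|_]; last by rewrite subr0.
have /forallP/(_ i) := mA; rewrite (negPf iA) implybF negbK => /eqP->.
by rewrite !expr0.
Qed.

(** By [mulXB_hcomplete_on] the product is a difference of a polynomial free of h_j and one free of
    h_i; each is killed by one of the two commuting differences. *)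
Lemma mDelta2_hcomplete i j L :
  mDelta i (mDelta j (('X_i - 'X_j) * hcomplete K n L)) = 0.
Proof.
rewrite /mDelta -hcomplete_onT mulXB_hcomplete_on ?in_setT //.
move: (mshift_hcomplete_on L.+1 (negbT (setD11 i setT))).
move: (mshift_hcomplete_on L.+1 (negbT (setD11 j setT))).
move: (hcomplete_on _ _) (hcomplete_on _ _) => a b aj bi.
have mshiftB k p q : mshift k (p - q) = mshift k p - mshift k q by exact: raddfB.
apply/eqP; rewrite subr_eq0 !mshiftB aj (mshiftC i j) bi !opprB.
by rewrite [eqbLHS]addrC [eqbRHS]addrC !addrA !subrK.
Qed.

Lemma hcomplete_uniq p (i0 : 'I_n) :
  (forall i j m, p@_(m + U_(i)) = p@_(m + U_(j))) ->
  p = \sum_(L < msize p) p@_(U_(i0) *+ L) *: hcomplete K n L.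
Proof.
move=> p_sym.
(* All exponents are moved to [i0] one unit at a time; [k] counts the units already moved. *)
have pE m k : p@_(m + U_(i0) *+ k) = p@_(U_(i0) *+ (mdeg m + k)).
  move Ed: (mdeg m) => d; elim: d => [|d IHd] in m k Ed *.
    by move/eqP: Ed; rewrite mdeg_eq0 => /eqP->; rewrite add0m.
  have [i mi] : exists i, m i != 0%N.
    apply/existsP; rewrite -[X in is_true X]negbK negb_exists; apply/negP => /forallP m0.
    move: Ed; rewrite mdegE big1 // => i _; apply/eqP.
    by move: (m0 i); rewrite negbK.
  move: Ed; rewrite -(submK (m := U_(i)%MM) (m' := m)) ?lep1mP // mdegD mdeg1 addn1.
  move=> [Ed]; rewrite -addmA [(U_(i) + _)%MM]addmC addmA (p_sym i i0) -addmA -mulmSr IHd //.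
  by rewrite addSnnS.
apply/mpolyP => m; rewrite raddf_sum /=.
under eq_bigr => L _ do rewrite mcoeffZ mcoeff_hcomplete.
have {1}-> : p@_m = p@_(U_(i0) *+ mdeg m) by rewrite -[mdeg m]addn0 -pE mulm0n addm0.
have [lt|ge] := ltnP (mdeg m) (msize p).
  rewrite (bigD1 (Ordinal lt)) //= eqxx mulr1 big1 ?addr0 // => L.
  by rewrite eq_sym -val_eqE /= => /negPf->; rewrite mulr0.
rewrite big1 => [|L _]; last first.
  by rewrite gtn_eqF ?mulr0 // (leq_trans (ltn_ord L)).
by apply: memN_msupp_eq0; rewrite msize_mdeg_ge // mdegMn mdeg1 mul1n.
Qed.

End Complete.

(** * Divided differences *)

Section DividedDifference.
Variables (I : finType) (F : fieldType) (x f : I -> F).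
Implicit Types (A : {set I}) (i j k : I).

(** The divided difference of [f] at the nodes [x k], [k] in [A], in Lagrange form. *)
Definition divdiff A := \sum_(k in A) f k / \prod_(l in A | l != k) (x k - x l).

Lemma divdiffD1 A i j : injective x -> i \in A -> j \in A -> i != j ->
  (x i - x j) * divdiff A = divdiff (A :\ j) - divdiff (A :\ i).
Proof.
move=> x_inj iA jA ij.
have x_neq k l : k != l -> x k - x l != 0.
  by move=> kl; rewrite subr_eq0; apply: contraNneq kl => /x_inj->.
have prodD1 k l : l \in A -> l != k -> \prod_(a in A | a != k) (x k - x a) =
    (x k - x l) * \prod_(a in A :\ l | a != k) (x k - x a).
  move=> lA lk; rewrite (bigD1 l) ?lA //=; congr (_ * _).
  by apply: eq_bigl => a; rewrite in_setD1 [LHS]andbC andbA.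
have prod_neq0 (B : {set I}) k : \prod_(a in B | a != k) (x k - x a) != 0.
  by apply/prodf_neq0 => a /andP[_ ak]; rewrite x_neq // eq_sym.
rewrite /divdiff (bigD1 i) //= [X in _ * (_ + X)](bigD1 j) /=; last by rewrite jA eq_sym.
rewrite [X in _ = X - _](bigD1 i) /=; last by rewrite in_setD1 ij iA.
rewrite [X in _ = _ - X](bigD1 j) /=; last by rewrite in_setD1 eq_sym ij jA.
(* The terms [i] and [j] each occur in only one sum on the right; every other term occurs in
   both. *)
rewrite !mulrDr addrA opprD [RHS]addrACA; congr (_ + _).
  rewrite (prodD1 i j) 1?eq_sym // (prodD1 j i) //.
  by field; rewrite !prod_neq0 !x_neq // eq_sym.
have DAj k : (k \in A :\ j) && (k != i) = (k \in A) && (k != i) && (k != j).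
  by rewrite in_setD1 -andbA andbC.
have DAi k : (k \in A :\ i) && (k != j) = (k \in A) && (k != i) && (k != j).
  by rewrite in_setD1 [in RHS]andbAC -andbA andbC.
rewrite [X in _ = X - _](eq_bigl _ _ DAj) [X in _ = _ - X](eq_bigl _ _ DAi).
rewrite -sumrB mulr_sumr; apply: eq_bigr => k /andP[/andP[kA ki] kj].
have := prodD1 k i iA; rewrite eq_sym => /(_ ki).
have := prodD1 k j jA; rewrite eq_sym => /(_ kj).
move: (prod_neq0 A k) (prod_neq0 (A :\ i) k) (prod_neq0 (A :\ j) k).
move: (\prod_(a in A | _) _) => P P0 Pi0 Pj0 PPj PPi.
(* Each of the two differences cancels one factor of the denominator. *)
have xij : x i - x j = (x k - x j) - (x k - x i) by ring.
rewrite xij [LHS]mulrBl {1}PPj PPi.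
by field; rewrite Pi0 Pj0 !x_neq.
Qed.

End DividedDifference.

(** * Extension of injective morphisms to fraction fields *)

Section Fracmap.
Variables (R S : idomainType) (f : {rmorphism R -> S}).
Hypothesis f_inj : injective f.

Lemma fracmap_tofrac a : fracmap f a%:F = (f a)%:F.
Proof.
rewrite -[a%:F]divr1 -tofrac1 fracmap_div ?oner_neq0 //.
by rewrite rmorph1 tofrac1 divr1.
Qed.

Lemma fracmapD x y : fracmap f (x + y) = fracmap f x + fracmap f y.
Proof.
have f_neq0 a : a != 0 -> f a != 0.
  by rewrite -(rmorph0 f) (inj_eq f_inj).
rewrite (frac_numden x) (frac_numden y).
move: (denom_ratioP (repr x)) (denom_ratioP (repr y)).
move: (\n_ _) (\d_ _) (\n_ _) (\d_ _) => a b c d b0 d0.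
rewrite !fracmap_div // !addf_div ?tofrac_eq0 ?f_neq0 //.
by rewrite -!tofracM -!tofracD -!rmorphM -rmorphD -(fracmap_div _ f_inj) ?mulf_neq0.
Qed.

Lemma fracmapM x y : fracmap f (x * y) = fracmap f x * fracmap f y.
Proof.
rewrite (frac_numden x) (frac_numden y).
move: (denom_ratioP (repr x)) (denom_ratioP (repr y)).
move: (\n_ _) (\d_ _) (\n_ _) (\d_ _) => a b c d b0 d0.
rewrite !fracmap_div // !mulf_div.
by rewrite -!tofracM -!rmorphM -(fracmap_div _ f_inj) ?mulf_neq0.
Qed.

Lemma fracmap_sum (I : finType) (x : I -> {fraction R}) :
  fracmap f (\sum_i x i) = \sum_i fracmap f (x i).
Proof.
by apply: (big_morph _ fracmapD); rewrite -tofrac0 fracmap_tofrac rmorph0.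
Qed.

End Fracmap.

Lemma big_option (V : nmodType) (I : finType) (F : option I -> V) :
  \sum_o F o = F None + \sum_i F (Some i).
Proof.
rewrite (bigD1 None) //=; congr (_ + _).
rewrite (reindex_omap Some id) => [|[] //].
by apply: eq_bigl => i; rewrite eqxx.
Qed.

(** * Part (i): divided differences of powers *)

Section CompleteSums.
Variables (K : fieldType) (n : nat).

Local Notation U := {mpoly K[n]}.
Local Notation F := {fraction U}.
Implicit Types (i j k : 'I_n) (A : {set 'I_n}) (L : nat).

Lemma mpolyX_inj : injective (fun i : 'I_n => 'X_i : U).
Proof.
move=> i j /(congr1 (mcoeff U_(i))) /eqP; rewrite !mcoeffXU eqxx.
by have [->//|_] := eqVneq j i; rewrite mulr1n mulr0n oner_eq0.
Qed.

Lemma mpolyXB_neq0 i j : i != j -> 'X_i - 'X_j != 0 :> U.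
Proof. by rewrite subr_eq0 (inj_eq mpolyX_inj). Qed.

Lemma hcomplete_on1 j L : hcomplete_on K [set j] L = 'X_j ^+ L.
Proof.
apply/mpolyP => m; rewrite mcoeff_hcomplete_on mcoeffXn; congr (nat_of_bool _)%:R.
apply/andP/eqP => [[/eqP <- /forallP mj]|<-].
  have m0 k : k != j -> m k = 0%N.
    by move=> /negPf kj; have := mj k; rewrite in_set1 kj implybF negbK => /eqP.
  apply/mnmP => k; rewrite mulmnE mnm1E mdegE (bigD1 j) //= big1 // addn0.
  by have [<-|/m0->] := eqVneq k j; rewrite ?mul1n // eq_sym.
split; first by rewrite mdegMn mdeg1 mul1n.
by apply/forallP => k; rewrite mulmnE mnm1E in_set1 [k == j]eq_sym; case: (j == k); rewrite ?implybT ?mul0n.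
Qed.

Lemma hcomplete_on0 A : hcomplete_on K A 0 = 1.
Proof.
apply/mpolyP => m; rewrite mcoeff_hcomplete_on mcoeff1 mdeg_eq0.
case: eqP => [->|//]; rewrite (_ : mnm_on _ _) //.
by apply/forallP => i; rewrite mnm0E.
Qed.

(** Induction on the size of [A]: [divdiffD1] and [mulXB_hcomplete_on] give both sides the same
    recurrence, and h_i - h_j can be cancelled. *)
Lemma divdiff_hcomplete_on A L : A != set0 ->
  divdiff (fun i => ('X_i : U)%:F) (fun i => ('X_i ^+ L)%:F) A =
  if (L.+1 < #|A|)%N then 0 else (hcomplete_on K A (L.+1 - #|A|))%:F.
Proof.
have X_inj : injective (fun i : 'I_n => ('X_i : U)%:F).
  by move=> i j /eqP; rewrite tofrac_eq => /eqP/mpolyX_inj.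
rewrite -card_gt0; move Ec : #|A| => c; case: c => // c in Ec * => _.
elim: c => [|c IHc] in A Ec *.
  have /cards1P[j ->] : #|A| == 1%N by rewrite Ec.
  rewrite ltnS ltn0 subn1 hcomplete_on1 /divdiff big_set1 big1 ?divr1 //.
  by move=> l; rewrite in_set1 andbN.
have /card_gt1P[i [j [iA jA ij]]] : (1 < #|A|)%N by rewrite Ec.
have Xij : ('X_i : U)%:F - ('X_j)%:F != 0.
  by rewrite -tofracB tofrac_eq0 mpolyXB_neq0.
apply: (mulfI Xij); rewrite divdiffD1 //.
have cD1 k : k \in A -> #|A :\ k| = c.+1.
  by move=> kA; move: Ec; rewrite (cardsD1 k) kA => -[].
(* The smaller sums both vanish for [L < c], and are both H_0 = 1 for [L = c], so that they cancel;
   the recurrence proper is the case [L > c]. *)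
rewrite !IHc ?cD1 //; case: (ltngtP L c) => [Lc|Lc|->].
- by rewrite !ltnS Lc (ltnW Lc) subr0 mulr0.
- rewrite !ltnS (leqNgt L c) Lc (ltnNge L c) (ltnW Lc) /= -tofracB.
  have -> : (L.+1 - c.+1 = (L.+1 - c.+2).+1)%N by rewrite subnSK.
  by rewrite -tofracM mulXB_hcomplete_on // tofracB.
by rewrite !ltnS ltnn leqnn !subSS subnn !hcomplete_on0 subrr mulr0.
Qed.

Lemma sum_Xn_chi L : (0 < n)%N ->
  \sum_(j < n) ('X_j ^+ L)%:F / (chi K j)%:F =
  (if (L.+1 < n)%N then 0 else (hcomplete K n (L.+1 - n))%:F) :> F.
Proof.
move=> n_gt0.
have nT : [set: 'I_n] != set0.
  by apply/set0Pn; exists (Ordinal n_gt0); rewrite in_setT.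
have := divdiff_hcomplete_on L nT; rewrite cardsT card_ord hcomplete_onT => <-.
apply: eq_big => [j|j _]; first by rewrite in_setT.
rewrite /chi rmorph_prod; congr (_ / _).
by apply: eq_big => [k|k _]; rewrite ?in_setT //= tofracB.
Qed.

End CompleteSums.

(** * The space W and its diagonal elements *)

Section WSpace.
Variables (K : fieldType) (n : nat).

Local Notation U := {mpoly K[n]}.
Local Notation F := {fraction U}.
Implicit Types (i j k : 'I_n) (p q : {poly K}) (P : 'I_n -> {poly K}).

Lemma constM (a : K) (u : U) : const n a * u%:F = (a *: u)%:F.
Proof. by rewrite -tofracM mul_mpolyC. Qed.

Lemma chi_neq0 j : chi K j != 0.
Proof. by apply/prodf_neq0 => k kj; rewrite mpolyXB_neq0 // eq_sym. Qed.

Definition wfrac j p : F := (horner_alg ('X_j : U) p)%:F / (chi K j)%:F.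
Definition wsum p : F := \sum_j wfrac j p.

Lemma wfrac_lin j a p q : wfrac j (a *: p + q) = const n a * wfrac j p + wfrac j q.
Proof. by rewrite /wfrac linearP /= mulr_algl tofracD -constM mulrDl mulrA. Qed.

Lemma wfracB j p q : wfrac j (p - q) = wfrac j p - wfrac j q.
Proof. by rewrite /wfrac rmorphB tofracB mulrBl. Qed.

Lemma wfracD j p q : wfrac j (p + q) = wfrac j p + wfrac j q.
Proof. by rewrite /wfrac rmorphD tofracD mulrDl. Qed.

Lemma wfrac0 j : wfrac j 0 = 0.
Proof. by rewrite /wfrac rmorph0 tofrac0 mul0r. Qed.

Lemma wsum0 : wsum 0 = 0.
Proof. by rewrite /wsum big1 // => j _; rewrite wfrac0. Qed.

Lemma wsum_lin a p q : wsum (a *: p + q) = const n a * wsum p + wsum q.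
Proof.
by rewrite /wsum mulr_sumr -big_split; apply: eq_bigr => j _; apply: wfrac_lin.
Qed.

Lemma wsum_comb N (c : 'I_N -> K) (p : 'I_N -> {poly K}) :
  wsum (\sum_L c L *: p L) = \sum_L const n (c L) * wsum (p L).
Proof.
pose R q (x : F) := wsum q = x.
apply: (big_rec2 R) => [|L q x _ Rq]; first exact: wsum0.
by rewrite /R wsum_lin Rq.
Qed.

Lemma horner_algE (u : U) p : horner_alg u p = \sum_(L < size p) p`_L *: u ^+ L.
Proof.
rewrite -{1}[p]coefK poly_def raddf_sum /=; apply: eq_bigr => L _.
by rewrite linearZ rmorphXn /= horner_algX mulr_algl.
Qed.

Lemma horner_alg_inj k : injective (horner_alg ('X_k : U)).
Proof.
have coefXk p d : (horner_alg ('X_k : U) p)@_(U_(k) *+ d) = p`_d.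
  rewrite horner_algE raddf_sum /=.
  under eq_bigr => L _ do rewrite mcoeffZ mcoeffXn.
  have [lt|ge] := ltnP d (size p); last first.
    rewrite nth_default // big1 // => L _; case: eqP => [|_]; last by rewrite mulr0.
    move/(congr1 (@mdeg n)); rewrite !mdegMn mdeg1 !mul1n => Ld.
    by move: (ltn_ord L); rewrite Ld ltnNge ge.
  rewrite (bigD1 (Ordinal lt)) //= eqxx mulr1 big1 ?addr0 // => L /eqP Ld.
  case: eqP => [|_]; last by rewrite mulr0.
  move/(congr1 (@mdeg n)); rewrite !mdegMn mdeg1 !mul1n => E.
  by case: Ld; apply: val_inj.
by move=> p q E; apply/polyP => d; rewrite -!coefXk E.
Qed.

Lemma rmorph_horner_alg (f : {lrmorphism U -> U}) j p :
  f (horner_alg ('X_j : U) p) = horner_alg (f 'X_j) p.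
Proof.
by rewrite !horner_algE raddf_sum; apply: eq_bigr => L _; rewrite /= linearZ rmorphXn.
Qed.

Lemma WP x : W K n x <-> exists P, x = \sum_j wfrac j (P j).
Proof.
split=> [[v [/fin_all_exists[P vP] ->]]|[P ->]].
  by exists P; apply: eq_bigr => j _; apply: vP.
by exists (fun j => wfrac j (P j)); split=> // j; exists (P j).
Qed.

Lemma subspace_W : subspace (W K n).
Proof.
split=> [|a x y /WP[P ->] /WP[Q ->]]; apply/WP.
  by exists (fun=> 0); rewrite big1 // => j _; apply: wfrac0.
exists (fun j => a *: P j + Q j); rewrite mulr_sumr -big_split.
by apply: eq_bigr => j _; rewrite wfrac_lin.
Qed.

(** By (i), [wsum] kills the powers below n-1 and sends the power n-1+L to H_L. *)
Lemma HspanP (n_gt0 : (0 < n)%N) x : Hspan K n x <-> exists p, x = wsum p.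
Proof.
have wsumXn L : wsum 'X^L = (if (L.+1 < n)%N then 0 else (hcomplete K n (L.+1 - n))%:F).
  rewrite -sum_Xn_chi //; apply: eq_bigr => j _.
  by rewrite /wfrac rmorphXn /= horner_algX.
have wsumXnD L : wsum 'X^(n.-1 + L) = (hcomplete K n L)%:F.
  by rewrite wsumXn -addSn prednK // -ltn_subRL subnn ltn0 addKn.
split=> [[N [c ->]]|[p ->]].
  exists (\sum_(L < N) c L *: 'X^(n.-1 + L)).
  rewrite wsum_comb rmorph_sum; apply: eq_bigr => L _ /=.
  by rewrite wsumXnD constM.
(* Padding with zero coefficients lets the sum be split at [n.-1], whatever the degree of [p]. *)
have -> : p = \sum_(L < n.-1 + size p) p`_L *: 'X^L.
  rewrite -poly_def; apply/polyP => L; rewrite coef_poly; case: ltnP => // ge.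
  by rewrite nth_default // (leq_trans _ ge) ?leq_addl.
exists (size p), (fun L => p`_(n.-1 + L)).
rewrite wsum_comb big_split_ord /= big1 ?add0r => [|L _].
  by rewrite rmorph_sum; apply: eq_bigr => L _ /=; rewrite wsumXnD constM.
by rewrite wsumXn -ltn_predRL ltn_ord mulr0.
Qed.

Lemma subspace_Hspan : (0 < n)%N -> subspace (Hspan K n).
Proof.
move=> n_gt0; split=> [|a x y /HspanP-/(_ n_gt0)[p ->] /HspanP-/(_ n_gt0)[q ->]].
  by apply/HspanP => //; exists 0; rewrite wsum0.
by apply/HspanP => //; exists (a *: p + q); rewrite wsum_lin.
Qed.

Lemma Hspan_W : (0 < n)%N -> forall x, Hspan K n x -> W K n x.
Proof. by move=> n_gt0 x /HspanP-/(_ n_gt0)[p ->]; apply/WP; exists (fun=> p). Qed.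

(** * Residues along the hyperplane h_i = h_k *)

Section Residue.
Variables (i k : 'I_n).
Hypothesis ik : i != k.

Definition subst_eq : U -> U :=
  comp_mpoly [tuple if l == i then 'X_k else 'X_l | l < n].

HB.instance Definition _ := GRing.LRMorphism.copy subst_eq
  (comp_mpoly [tuple if l == i then 'X_k else 'X_l | l < n]).

(** The local ring of the hyperplane h_i = h_k; [subst_eq] is restriction to it. *)
Definition regular_at (x : F) := exists a b : U, subst_eq b != 0 /\ x = a%:F / b%:F.

Lemma regular_atB x y : regular_at x -> regular_at y -> regular_at (x - y).
Proof.
move=> [a [b [b0 ->]]] [c [d [d0 ->]]].
have neq0 e : subst_eq e != 0 -> e%:F != 0.
  by rewrite tofrac_eq0; apply: contraNneq => ->; rewrite raddf0.
exists (a * d - c * b), (b * d); rewrite rmorphM mulf_neq0 //; split=> //.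
by rewrite -mulNr addf_div ?neq0 // tofracB !tofracM mulNr.
Qed.

Lemma regular_at_mpoly (u : U) : regular_at u%:F.
Proof. by exists u, 1; rewrite rmorph1 oner_neq0 tofrac1 divr1. Qed.

Lemma subst_eqX l : subst_eq 'X_l = if l == i then 'X_k else 'X_l.
Proof. by rewrite /subst_eq comp_mpolyXU -tnth_nth tnth_mktuple. Qed.

Lemma regular_at_wfrac l p : l != i -> l != k -> regular_at (wfrac l p).
Proof.
move=> li lk; exists (horner_alg ('X_l : U) p), (chi K l); split=> //.
rewrite /chi rmorph_prod; apply/prodf_neq0 => a al.
rewrite rmorphB /= !subst_eqX (negPf li); case: ifP => _;
  by rewrite mpolyXB_neq0 // eq_sym.
Qed.

(** The terms other than [i] and [k] are regular, so the sum of these two is. Their denominators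
    agree up to sign on the hyperplane once h_i - h_k is removed, so the residue is a nonzero
    multiple of the difference of the numerators. *)
Lemma regular_eq P : regular_at (\sum_l wfrac l (P l)) -> P i = P k.
Proof.
rewrite (bigD1 i) //= (bigD1 k) 1?eq_sym //= addrA => reg.
have {reg} : regular_at (wfrac i (P i) + wfrac k (P k)).
  rewrite -[_ + _](addrK (\sum_(l < n | (l != i) && (l != k)) wfrac l (P l))).
  apply: regular_atB => //; apply: (big_ind regular_at).
  - by rewrite -tofrac0; apply: regular_at_mpoly.
  - move=> x y xr yr; rewrite -[y]opprK -[- y]sub0r; apply: regular_atB => //.
    by apply: regular_atB => //; rewrite -tofrac0; apply: regular_at_mpoly.
  - by move=> l /andP[li lk]; apply: regular_at_wfrac.
case=> a [b [b0]].
pose A j : U := \prod_(l < n | (l != i) && (l != k)) ('X_j - 'X_l).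
have chi_i : chi K i = ('X_i - 'X_k) * A i by rewrite /chi (bigD1 k) 1?eq_sym.
have chi_k : chi K k = - ('X_i - 'X_k) * A k.
  rewrite /chi (bigD1 i) //= opprB; congr (_ * _).
  by apply: eq_bigl => l; rewrite andbC.
have substA : (subst_eq (A i) = A k) * (subst_eq (A k) = A k).
  rewrite !rmorph_prod; split; apply: eq_bigr => l /andP[li lk];
  by rewrite rmorphB /= !subst_eqX ?eqxx (negPf li) // eq_sym (negPf ik).
have A_neq0 : A k != 0.
  by apply/prodf_neq0 => l /andP[_ lk]; rewrite mpolyXB_neq0 // eq_sym.
have Ai_neq0 : A i != 0.
  by apply/prodf_neq0 => l /andP[li _]; rewrite mpolyXB_neq0 // eq_sym.
have b_neq0 : b != 0 by apply: contraNneq b0 => ->; rewrite raddf0.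
rewrite /wfrac; set r := horner_alg 'X_i (P i); set s := horner_alg 'X_k (P k).
rewrite addf_div ?tofrac_eq0 ?chi_neq0 // -!tofracM -tofracD => /eqP.
rewrite eqr_div ?tofrac_eq0 ?mulf_neq0 ?chi_neq0 // -!tofracM tofrac_eq => /eqP.
rewrite chi_i chi_k => E.
(* One factor h_i - h_k is cancelled; the one left makes the right side vanish on the hyperplane. *)
have {}E : b * (r * A k - s * A i) = a * ('X_i - 'X_k) * A i * A k.
  apply: (mulfI (mpolyXB_neq0 K ik)).
  transitivity (- ((r * (- ('X_i - 'X_k) * A k) + s * (('X_i - 'X_k) * A i)) * b)).
    by ring.
  by rewrite E; ring.
move/(congr1 subst_eq)/eqP: E.
rewrite !rmorphM !rmorphB !rmorphM /= !substA !subst_eqX eqxx [k == i]eq_sym (negPf ik).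
rewrite subrr !(mulr0, mul0r) mulf_eq0 (negPf b0) /= -mulrBl mulf_eq0 (negPf A_neq0).
rewrite orbF subr_eq0 !rmorph_horner_alg /= !subst_eqX eqxx [k == i]eq_sym (negPf ik).
by move/eqP/horner_alg_inj.
Qed.

End Residue.

Lemma wfrac_sum_mpoly P (u : U) :
  \sum_l wfrac l (P l) = u%:F -> forall i k, P i = P k.
Proof.
move=> E i k; have [->//|ik] := eqVneq i k.
by apply: (regular_eq ik); rewrite E; apply: regular_at_mpoly.
Qed.


End WSpace.

(** * Permutations, and parts (ii) and (iii) *)

Section Symmetry.
Variables (K : fieldType) (n : nat).

Local Notation U := {mpoly K[n]}.
Local Notation F := {fraction U}.
Implicit Types (i j k : 'I_n) (p q : {poly K}) (P : 'I_n -> {poly K}).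

Lemma msymXU i (s : 'S_n) : msym s ('X_i : U) = 'X_(s i).
Proof. by rewrite /msym mmapX mmap1U. Qed.

Lemma in_barU_permute x (s : 'S_n) : in_barU x -> in_barU (permute x s : F).
Proof.
case=> [u [d [den_d ->]]]; exists (msym s u), (msym s d); split.
  elim: den_d => [|i j a e ij _ IH]; first by rewrite msym1; constructor.
  rewrite msymM rmorphD rmorphB rmorph_int /= !msymXU; constructor => //.
  by rewrite (inj_eq perm_inj).
by rewrite /permute fracmap_div ?denominator_neq0 //; apply: inj_msym.
Qed.

Lemma permute_tofrac (u : U) (s : 'S_n) : permute u%:F s = (msym s u)%:F.
Proof. by apply: fracmap_tofrac; apply: inj_msym. Qed.

Lemma acts_permute : acts_on_ring (@in_barU K n) permute.
Proof.
split; split.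
- exact: in_barU_permute.
- move=> x _; rewrite [in LHS](frac_numden x) /permute fracmap_div ?denom_ratioP //.
    by rewrite /= !msym1m -frac_numden.
  exact: inj_msym.
- move=> x s t _; rewrite (frac_numden x); move: (denom_ratioP (repr x)).
  move: (\n_ _) (\d_ _) => a b b0.
  have msymE r : permute (a%:F / b%:F) r = (msym r a)%:F / (msym r b)%:F.
    by apply: fracmap_div => //; apply: inj_msym.
  rewrite !msymE !msymMm /permute fracmap_div //; first exact: inj_msym.
  by apply: contraNneq b0 => E; apply/eqP/(inj_msym s); rewrite E msym0.
- by move=> x y s _ _; apply: fracmapD; apply: inj_msym.
- by move=> x y s _ _; apply: fracmapM; apply: inj_msym.
- by move=> a s; rewrite /const permute_tofrac /msym mmapC.
Qed.

Lemma permute_X i (s : 'S_n) : permute ('X_i : U)%:F s = ('X_(s i))%:F.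
Proof. by rewrite permute_tofrac msymXU. Qed.

Lemma permute_wfrac j p (s : 'S_n) : permute (wfrac j p) s = wfrac (s j) p.
Proof.
rewrite /permute /wfrac fracmap_div ?chi_neq0 //; last exact: inj_msym.
rewrite /= rmorph_horner_alg /= msymXU; congr (_ / _%:F).
rewrite /chi rmorph_prod [RHS](reindex_inj (@perm_inj _ s)).
apply: eq_big => [k|k _]; first by rewrite (inj_eq perm_inj).
by rewrite rmorphB /= !msymXU.
Qed.

Lemma permute_sum_wfrac P (s : 'S_n) :
  permute (\sum_j wfrac j (P j)) s = \sum_j wfrac (s j) (P j).
Proof.
rewrite /permute fracmap_sum; last exact: inj_msym.
by apply: eq_bigr => j _; apply: permute_wfrac.
Qed.

Lemma W_permute x (s : 'S_n) : W K n x -> W K n (permute x s).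
Proof.
move=> /WP[P ->]; apply/WP; exists (fun j => P (s^-1%g j)).
rewrite permute_sum_wfrac [RHS](reindex_inj (@perm_inj _ s)).
by apply: eq_bigr => j _; rewrite permK.
Qed.

Hypothesis n_gt0 : (0 < n)%N.

Lemma Hspan_eqP x : Hspan K n x <->
  exists P, (forall i k, P i = P k) /\ x = \sum_j wfrac j (P j).
Proof.
split=> [/HspanP-/(_ n_gt0)[p ->]|[P [Peq ->]]]; first by exists (fun=> p).
apply/HspanP => //; exists (P (Ordinal n_gt0)); apply: eq_bigr => j _.
by rewrite (Peq j (Ordinal n_gt0)).
Qed.

Lemma Hspan_mpoly x : Hspan K n x <-> W K n x /\ in_U x.
Proof.
split=> [Hx|[/WP[P ->] [u E]]]; last first.
  by apply/Hspan_eqP; exists P; split=> //; apply: wfrac_sum_mpoly E.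
split; first exact: Hspan_W.
by case: Hx => N [c ->]; exists (\sum_(L < N) c L *: hcomplete K n L).
Qed.

Lemma sum_wfracB P (Q : 'I_n -> {poly K}) :
  \sum_j wfrac j (P j - Q j) = \sum_j wfrac j (P j) - \sum_j wfrac j (Q j).
Proof. by rewrite -sumrB; apply: eq_bigr => j _; rewrite wfracB. Qed.

Hypothesis charK : [pchar K] =i pred0.

Lemma Hspan_invariant x :
  Hspan K n x <-> W K n x /\ (forall s, permute x s = x).
Proof.
split=> [/HspanP-/(_ n_gt0)[p ->]|[/WP[P ->] Pinv]].
  split=> [|s]; first by apply/WP; exists (fun=> p).
  by rewrite permute_sum_wfrac [RHS](reindex_inj (@perm_inj _ s)).
apply/Hspan_eqP; exists P; split=> // i k.
pose s := tperm i k.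
(* This is [x] minus its image under the transposition. Its numerators are all equal, while those at
   [i] and [k] are opposite, so twice [P i - P k] is 0. *)
have : \sum_j wfrac j (P j - P (s j)) = (0 : U)%:F.
  rewrite sum_wfracB tofrac0 -{1}(Pinv s) permute_sum_wfrac.
  rewrite [X in X - _](reindex_inj (@perm_inj _ s)) -sumrB big1 // => j _.
  by rewrite tpermK subrr.
move/wfrac_sum_mpoly/(_ i k); rewrite tpermL tpermR => E.
apply/polyP => d; move/(congr1 (coefp d)): E; rewrite /= !coefB.
move: (P i)`_d (P k)`_d => a b E; apply/eqP; rewrite -subr_eq0.
have : (a - b) * 2%:R == 0 by rewrite mulr_natr mulr2n {2}E addrA subrK subrr.
by rewrite mulf_eq0 ((pcharf0P K).1 charK) orbF.
Qed.

Lemma Hspan_system (u : U) :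
  (forall i j, Delta i (Delta j (('X_i - 'X_j)%:F * u%:F)) = 0)
    <-> Hspan K n u%:F.
Proof.
have mshiftE i (v : U) : Delta i v%:F = (mDelta i v)%:F.
  rewrite /Delta /shift /mDelta tofracB; congr (_ - _).
  by rewrite /mshift fracmap_tofrac //; apply: mshift_inj.
have systemE : (forall i j, Delta i (Delta j (('X_i - 'X_j)%:F * u%:F)) = 0) <->
    (forall i j, mDelta i (mDelta j (('X_i - 'X_j) * u)) = 0).
  split=> E i j; have := E i j; rewrite -tofracM !mshiftE.
    by move/eqP; rewrite tofrac_eq0 => /eqP.
  by move=> ->; rewrite tofrac0.
rewrite systemE; split=> [E|[N [c /eqP]]]; last first.
  rewrite tofrac_eq => /eqP -> i j; rewrite mulr_sumr.
  under eq_bigr => L _ do rewrite -scalerAr.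
  rewrite !mDelta_lin big1 // => L _.
  by rewrite mDelta2_hcomplete scaler0.
(* The multiplier of H_L can be read off any monomial of degree [L], here a power of the first
   variable. *)
exists (msize u), (fun L => u@_(U_(Ordinal n_gt0) *+ L)).
apply/eqP; rewrite tofrac_eq; apply/eqP; apply: hcomplete_uniq => i j m.
have [->//|ij] := eqVneq i j.
(* The coefficient of (h_i - h_j) sigma at [m + U_(j) + U_(i)] is the difference of those of sigma
   at [m + U_(j)] and [m + U_(i)]. *)
have /mderiv2_eq0_mcoeff-/(_ charK m) := mDelta2_mderiv charK (E i j).
rewrite mulrC mulrBr mcoeffB [(m + U_(j) + _)%MM]addmC mcoeffMX.
by rewrite addmA [(U_(i) + m)%MM]addmC [(m + _ + U_(j))%MM]addmC mcoeffMX => /subr0_eq.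
Qed.

Lemma W_direct_sum j :
  direct_sum (fun o : option {k : 'I_n | k != j} =>
    if o is Some k then Wj (val k) else Hspan K n) (W K n).
Proof.
split=> [x|v vA v0].
  split=> [/WP[P ->]|[v [vA ->]]].
    pose R k := P k - P j.
    exists (fun o => if o is Some k then wfrac (val k) (R (val k)) else wsum n (P j)).
    split=> [[k|]|]; first by exists (R (val k)).
      by apply/HspanP => //; exists (P j).
    rewrite big_option -(big_sub [pred k | k != j] (fun k => wfrac k (R k))) /=.
    rewrite /wsum (bigD1 j) //= [in RHS](bigD1 j) //= -addrA; congr (_ + _).
    rewrite -big_split; apply: eq_bigr => k _ /=.
    by rewrite -wfracD addrC subrK.
  have [W0 Wlin] := subspace_W K n.
  apply: (big_ind (W K n)) => // [y z Wy Wz|[k|] _].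
  - have -> : y + z = const n 1 * y + z by rewrite /const mpolyC1 tofrac1 mul1r.
    exact: Wlin.
  - have [p ->] := vA (Some k); apply/WP.
    exists (fun i => if i == val k then p else 0).
    rewrite (bigD1 (val k)) //= eqxx big1 ?addr0 // => i /negPf->.
    exact: wfrac0.
  - exact: Hspan_W (vA None).
have [p vp] : exists p, v None = wsum n p by apply/HspanP => //; apply: vA None.
have /fin_all_exists[Q vQ] : forall k : {k | k != j}, exists q, v (Some k) = wfrac (val k) q.
  by move=> k; apply: vA (Some k).
(* [Q] is extended by 0 at [j]. The relation then has numerators [p + R k], all equal to the one at
   [j], which is [p]; hence every [Q k] is 0. *)
pose R k := oapp Q 0 (insub k).
have RE (k : {k | k != j}) : R (val k) = Q k by rewrite /R valK.
have Rj : R j = 0 by rewrite /R insubN ?negbK.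
have sumR : \sum_k wfrac k (p + R k) = (0 : U)%:F.
  rewrite tofrac0 -[RHS]v0 big_option vp /wsum.
  have -> : \sum_k v (Some k) = \sum_k wfrac k (R k).
    rewrite [RHS](bigD1 j) //= Rj wfrac0 add0r (big_sub [pred k | k != j]).
    by apply: eq_bigr => k _; rewrite vQ RE.
  by rewrite -big_split; apply: eq_bigr => k _; apply: wfracD.
have v_some (k : {k | k != j}) : v (Some k) = 0.
  have := wfrac_sum_mpoly sumR (val k) j; rewrite Rj RE => /addrI Qk.
  by rewrite vQ Qk wfrac0.
case=> [k|]; first exact: v_some.
by move: v0; rewrite big_option big1 ?addr0.
Qed.

End Symmetry.

Theorem lemma3p5 (K : fieldType) (n : nat) (charK : [pchar K] =i pred0)
    (n_gt0 : (0 < n)%N) :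
  (* (i) *)
  (forall L : nat,
     \sum_(j < n) ('X_j ^+ L)%:F / (chi K j)%:F
     = (if (L.+1 < n)%N then 0 else (hcomplete K n (L.+1 - n))%:F)
       :> {fraction {mpoly K[n]}})
  /\
  (* (ii) *)
  [/\ [/\ subspace (W K n), subspace (Hspan K n)
        & forall x, Hspan K n x -> W K n x],
      forall sigma : {mpoly K[n]},
        (forall i j : 'I_n,
           Delta i (Delta j (('X_i - 'X_j)%:F * sigma%:F)) = 0)
        <-> Hspan K n sigma%:F,
      forall x, Hspan K n x <-> W K n x /\ in_U x,
      [/\ acts_on_ring (@in_barU K n) permute,
          forall (i : 'I_n) (s : 'S_n),
            permute ('X_i : {mpoly K[n]})%:F s = ('X_(s i))%:F
        & forall x s, W K n x -> W K n (permute x s)]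
    & forall x, Hspan K n x <-> W K n x /\ (forall s, permute x s = x)]
  /\
  (* (iii) *)
  (forall j : 'I_n,
     direct_sum
       (fun o : option {k : 'I_n | k != j} =>
          if o is Some k then Wj (val k) else Hspan K n)
       (W K n)).
Proof.
split; first by move=> L; apply: sum_Xn_chi.
split; last by move=> j; apply: W_direct_sum.
split.
- by split; [apply: subspace_W | apply: subspace_Hspan | apply: Hspan_W].
- by move=> sigma; apply: Hspan_system.
- exact: Hspan_mpoly.
- by split; [apply: acts_permute | apply: permute_X | apply: W_permute].
- exact: Hspan_invariant.
Qed.
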